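(* Let $N = p^k m^2$ be an odd perfect number given in Eulerian form. Then $m^2 - p^k > 2m$.
   Context: A positive integer $N$ is an odd perfect number if $N$ is odd and $\sigma(N) = 2N$, where $\sigma$ denotes the sum-of-divisors function. An odd perfect number is said to be given in Eulerian form $N = p^k m^2$ if $p$ is a prime (the special prime), $k$ and $m$ are positive integers, $p \equiv k \equiv 1 \pmod 4$, and $\gcd(p,m) = 1$. *)

(* Defs.v *)
From mathcomp Require Import all_boot all_order all_algebra.

Set Implicit Arguments.
Unset Strict Implicit.
Unset Printing Implicit Defensive.

Definition sigma (n : nat) : nat := \sum_(d <- divisors n) d.

Definition odd_perfect (N : nat) : Prop :=
  [/\ 0 < N, odd N & sigma N = 2 * N].

Definition eulerian_form (N p k m : nat) : Prop :=
  [/\ N = p ^ k * m ^ 2,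
      prime p,
      0 < k /\ 0 < m,
      p = 1 %[mod 4] /\ k = 1 %[mod 4]
    & gcdn p m = 1].

(* Main.v *)
Require Import Defs.
From mathcomp Require Import all_boot all_order all_algebra.
From mathcomp Require Import zify.

(** Since [p ^ k] is coprime to [sigma (p ^ k)], we can write
    [sigma (m ^ 2) = s * p ^ k] and [sigma (p ^ k) * s = 2 * m ^ 2], and [s]
    divides [m ^ 2] because [sigma (p ^ k)] is even.  If [s = 1] then, for
    every prime [q] with [q ^ e || m] and [0 < e], the number
    [x = sigma (q ^ (2 * e))] is a power of [p] with [q || x - 1], so lifting
    the exponent gives
    [2 * e <= v_q (p ^ (k + 1) - 1) <= v_q (x ^ (k + 1) - 1) = 1 + v_q (k + 1)].
    Hence [m] divides [k + 1], which is impossible since [p ^ k < 2 * m ^ 2].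
    So the odd number [s] is at least [3], and [3 * p ^ k < 2 * m ^ 2], which
    suffices once [6 <= m].  Finally [m] is not [1], [3] or [5]: [s] is a common
    divisor of [m ^ 2] and [sigma (m ^ 2)], which are coprime when [m] is a
    prime power. *)

(* The binomial terms of degree at least 2 in [q * t] are divisible by
   [q ^ 3 * t]: those of degree less than [q] through the coefficient, and the
   last one because [3 <= q]. *)
Lemma expnD_odd_prime (q t y : nat) : prime q -> odd q ->
  exists r, (y + q * t) ^ q = y ^ q + q * (q * t) * (y ^ q.-1 + q * r).
Proof.
move=> q_pr q_odd; have q_gt2 := odd_prime_gt2 q_odd q_pr.
pose F i := 'C(q, i) * (y ^ (q - i) * (q * t) ^ i).
have tail_dvd i : 1 < i <= q -> q ^ 3 * t %| F i.
  case: i => [|[|i]] // /andP[_]; rewrite leq_eqVlt => /predU1P[iq | iq].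
  - case: i iq => [|i] iq; first by move: q_gt2; rewrite -iq.
    rewrite /F !(expnS (q * t)); apply/dvdnP.
    by exists ('C(q, i.+3) * y ^ (q - i.+3) * t ^ 2 * (q * t) ^ i); nia.
  - have /dvdnP[c binE] := @prime_dvd_bin i.+2 q q_pr iq.
    rewrite /F binE !expnS; apply/dvdnP.
    by exists (c * y ^ (q - i.+2) * t * (q * t) ^ i); nia.
have /dvdnP[r tailE] : q ^ 3 * t %| \sum_(2 <= i < q.+1) F i.
  by rewrite big_nat; apply: dvdn_sum => i; rewrite ltnS; apply: tail_dvd.
exists r; rewrite expnDn -(big_mkord xpredT F).
rewrite big_ltn // big_ltn ?ltnS ?prime_gt0 //.
by rewrite tailE /F bin0 bin1 subn0 subn1 expn0 expn1; nia.
Qed.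

Section LiftingTheExponent.

Variables q x y : nat.
Hypotheses (q_pr : prime q) (ltyx : y < x).
Hypotheses (q_dvd : q %| x - y) (cqy : coprime q y).

Lemma logn_subn_exp_coprime (n : nat) :
  coprime q n -> logn q (x ^ n - y ^ n) = logn q (x - y).
Proof.
move=> cqn; rewrite subn_exp mulnC logn_Gauss //.
have xy : x = y %[mod q] by apply/eqP; rewrite eqn_mod_dvd // ltnW.
suff sumE : \sum_(i < n) x ^ (n.-1 - i) * y ^ i = n * y ^ n.-1 %[mod q].
  by rewrite -coprime_modr sumE coprime_modr coprimeMr cqn coprimeXr.
rewrite -modn_summ (eq_bigr (fun=> y ^ n.-1 %% q)) => [|i _].
  by rewrite modn_summ sum_nat_const card_ord.
rewrite -modnMml -modnXm xy modnXm modnMml -expnD subnK //.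
by rewrite -ltnS (ltn_predK (ltn_ord i)).
Qed.

Lemma logn_subn_exp_prime :
  odd q -> logn q (x ^ q - y ^ q) = (logn q (x - y)).+1.
Proof.
move=> q_odd; have /dvdnP[t] := q_dvd; rewrite mulnC => xyE.
have xE : x = y + q * t by rewrite -xyE subnKC // ltnW.
have [r rE] := expnD_odd_prime _ t y q_pr q_odd.
have qt_gt0 : 0 < q * t by rewrite -xyE subn_gt0.
rewrite xyE xE rE addKn mulnC logn_Gauss; last first.
  by rewrite -coprime_modr addnC mulnC modnMDl coprime_modr coprimeXr.
by rewrite lognM ?(prime_gt0 q_pr) // (logn_prime _ q_pr) eqxx.
Qed.

End LiftingTheExponent.

Lemma logn_subn_exp (q x y n : nat) : prime q -> odd q -> y < x ->
    q %| x - y -> coprime q y -> 0 < n ->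
  logn q (x ^ n - y ^ n) = logn q (x - y) + logn q n.
Proof.
move=> q_pr q_odd; elim/ltn_ind: n x y => n IHn x y ltyx q_dvd cqy n_gt0.
have [/dvdnP[l nE] | q_ndvd] := boolP (q %| n); last first.
  have cqn : coprime q n by rewrite prime_coprime.
  by rewrite logn_subn_exp_coprime // (logn_coprime cqn) addn0.
have l_gt0 : 0 < l by move: n_gt0; rewrite nE muln_gt0 => /andP[].
rewrite nE [l * q]mulnC !expnM IHn ?coprimeXr //.
- rewrite logn_subn_exp_prime // lognM ?(prime_gt0 q_pr) //.
  by rewrite (logn_prime _ q_pr) eqxx addSnnS.
- by rewrite nE ltn_Pmulr ?prime_gt1.
- by rewrite ltn_exp2r ?prime_gt0.
- by rewrite subn_exp dvdn_mulr.
Qed.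

Lemma logn_predn_exp (q x n : nat) : prime q -> odd q -> 1 < x ->
  q %| x.-1 -> 0 < n -> logn q (x ^ n).-1 = logn q x.-1 + logn q n.
Proof.
move=> q_pr q_odd x_gt1; rewrite -!subn1 => q_dvd n_gt0.
by rewrite -[X in x ^ n - X](exp1n n) logn_subn_exp ?coprimen1.
Qed.

Lemma dvdn_of_eq_mul (a d n s : nat) :
  0 < d -> d %| a -> a * s = d * n -> s %| n.
Proof.
move=> d_gt0 /dvdnP[c ->] /eqP; rewrite mulnAC mulnC eqn_pmul2l // => /eqP<-.
exact: dvdn_mull.
Qed.

Lemma gcdn_mul_coprime (a d e : nat) :
  d %| a -> coprime a e -> gcdn (d * e) a = d.
Proof. by move=> da cae; rewrite gcdnC Gauss_gcdl //; apply/gcdn_idPr. Qed.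

Lemma dvdn_mul_gcdn (a b d : nat) :
  coprime a b -> d %| a * b -> gcdn d a * gcdn d b = d.
Proof.
move=> cab dab; apply/eqP; rewrite eqn_dvd Gauss_dvd ?dvdn_gcdl; last first.
  exact: coprime_dvdl (dvdn_gcdr d a) (coprime_dvdr (dvdn_gcdr d b) cab).
by rewrite muln_gcdr dvdn_gcd dvdn_mull //= muln_gcdl dvdn_gcd dab dvdn_mulr.
Qed.

Lemma perm_divisorsM (a b : nat) : coprime a b ->
  perm_eq (divisors (a * b)) [seq d * e | d <- divisors a, e <- divisors b].
Proof.
have [-> | a_gt0] := posnP a; first by rewrite /coprime gcd0n => /eqP->.
have [-> | b_gt0] := posnP b; first by rewrite /coprime gcdn0 => /eqP->.
move=> cab; have cba : coprime b a by rewrite coprime_sym.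
apply: uniq_perm; first exact: divisors_uniq.
- apply: allpairs_uniq; try exact: divisors_uniq.
  apply: (@can_in_inj _ _ _ _ (fun n => (gcdn n a, gcdn n b))) => de.
  case/allpairsP=> -[d e] /= []; rewrite -!dvdn_divisors // => da eb -> /=.
  rewrite gcdn_mul_coprime ?(coprime_dvdr eb) // mulnC.
  by rewrite gcdn_mul_coprime ?(coprime_dvdr da).
- move=> d; rewrite -dvdn_divisors ?muln_gt0 ?a_gt0 //.
  apply/idP/allpairsP => [dab | [[x y] /= [xa yb ->]]]; last first.
    by apply: dvdn_mul; rewrite dvdn_divisors.
  exists (gcdn d a, gcdn d b); rewrite -!dvdn_divisors //= !dvdn_gcdr.
  by rewrite dvdn_mul_gcdn.
Qed.

Lemma sigmaM (a b : nat) : coprime a b -> sigma (a * b) = sigma a * sigma b.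
Proof.
move=> cab; rewrite /sigma (perm_big _ (perm_divisorsM _ _ cab)).
rewrite big_allpairs_dep big_distrl; apply: eq_bigr => d _.
by rewrite big_distrr.
Qed.

Lemma ltn_sigma (n : nat) : 1 < n -> n < sigma n.
Proof.
move=> n_gt1; have n_gt0 := ltnW n_gt1.
rewrite /sigma (bigD1_seq n) ?divisors_id ?divisors_uniq //= -[ltnLHS]addn0.
rewrite ltn_add2l lt0n sum_nat_seq_neq0; apply/hasP; exists 1.
  exact: divisor1.
by rewrite neq_ltn n_gt1.
Qed.

Lemma ltn_sigma_primeX (p k : nat) :
  prime p -> 0 < k -> p ^ k < sigma (p ^ k).
Proof.
move=> p_pr k_gt0; apply: ltn_sigma.
exact: leq_ltn_trans k_gt0 (ltn_expl k (prime_gt1 p_pr)).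
Qed.

Lemma sigma_primeX (p k : nat) :
  prime p -> sigma (p ^ k) = \sum_(i < k.+1) p ^ i.
Proof.
move=> p_pr; rewrite -(big_mkord xpredT) /sigma /index_iota subn0.
rewrite -(big_map (expn p) xpredT id); apply/perm_big/uniq_perm.
- exact: divisors_uniq.
- by rewrite map_inj_uniq ?iota_uniq //; apply/expnI/prime_gt1.
- move=> d; rewrite -dvdn_divisors ?expn_gt0 ?prime_gt0 //.
  by apply/dvdn_pfactor/mapP => // -[i ik ->]; exists i;
    rewrite // mem_iota in ik *.
Qed.

Lemma sigma_primeXS (p k : nat) :
  prime p -> sigma (p ^ k.+1) = (p * sigma (p ^ k)).+1.
Proof.
move=> p_pr; rewrite !sigma_primeX // big_ord_recl big_distrr add1n.
by congr _.+1; apply: eq_bigr => i _; rewrite expnS.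
Qed.

Lemma predn_primeXS (p k : nat) :
  prime p -> (p ^ k.+1).-1 = p.-1 * sigma (p ^ k).
Proof. by move=> p_pr; rewrite predn_exp sigma_primeX. Qed.

Lemma coprime_sigma_primeX (p k : nat) : prime p -> coprime p (sigma (p ^ k)).
Proof.
move=> p_pr; case: k => [|k]; first by rewrite /sigma big_seq1 coprimen1.
by rewrite sigma_primeXS // (coprime_dvdl (dvdn_mulr _ _) (coprimenS _)).
Qed.

Lemma logn_pred_sigma_primeX (q e : nat) : prime q -> 0 < e ->
  logn q (sigma (q ^ e)).-1 = 1.
Proof.
move=> q_pr; case: e => // e _; rewrite sigma_primeXS // mulnC.
by rewrite logn_Gauss ?coprime_sigma_primeX // (logn_prime _ q_pr) eqxx.
Qed.

Lemma odd_sigma_primeX (p k : nat) :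
  prime p -> odd p -> odd (sigma (p ^ k)) = ~~ odd k.
Proof.
move=> p_pr p_odd; elim: k => [|k IHk]; first by rewrite /sigma big_seq1.
by rewrite sigma_primeXS //= oddM p_odd IHk.
Qed.

Lemma coprime_sigma_sqr_lt6 (m : nat) :
  odd m -> m < 6 -> coprime (m ^ 2) (sigma (m ^ 2)).
Proof.
move=> m_odd m_lt6.
have : (m == 1) || prime m by move: m m_odd m_lt6; do 6?case.
case/orP => [/eqP-> | m_pr]; first exact: coprime1n.
by rewrite coprimeXl ?coprime_sigma_primeX.
Qed.

Lemma sigma_cofactor (c p k n : nat) : prime p -> coprime p n ->
    sigma (p ^ k * n) = c * (p ^ k * n) ->
  exists2 s, sigma n = s * p ^ k & sigma (p ^ k) * s = c * n.
Proof.
move=> p_pr cpn; have pk_gt0 : 0 < p ^ k by rewrite expn_gt0 prime_gt0.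
rewrite sigmaM ?coprimeXl // => sigE.
have /dvdnP[s sE] : p ^ k %| sigma n.
  rewrite -(@Gauss_dvdr _ (sigma (p ^ k))) ?coprimeXl ?coprime_sigma_primeX //.
  by rewrite sigE mulnCA dvdn_mulr.
exists s => //; apply/eqP; rewrite -(eqn_pmul2r pk_gt0) -mulnA -sE sigE.
by rewrite mulnAC mulnA.
Qed.

Lemma logn_leq_of_sigma_dvdn (p j k q n : nat) :
    prime p -> prime q -> odd q -> 0 < n ->
    sigma n %| p ^ j -> n %| sigma (p ^ k) ->
  logn q n <= (logn q k.+1).+1.
Proof.
move=> p_pr q_pr q_odd n_gt0 sig_dvd n_dvd.
have [-> // | e_gt0] := posnP (logn q n); set e := logn q n in e_gt0 *.
set x := sigma (q ^ e).
have [c _ xE] : exists2 c, c <= j & x = p ^ c.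
  apply/(dvdn_pfactor _ _ p_pr)/(dvdn_trans _ sig_dvd).
  have [n' cqn' nE] := pfactor_coprime q_pr n_gt0.
  by rewrite nE sigmaM ?dvdn_mull // coprime_sym coprimeXl.
have x_gt1 : 1 < x.
  apply: leq_ltn_trans (ltn_sigma_primeX _ _ q_pr e_gt0).
  by rewrite expn_gt0 prime_gt0.
have logn_x : logn q x.-1 = 1 by rewrite logn_pred_sigma_primeX.
have x_pred_gt0 : 0 < x.-1 by rewrite -subn1 subn_gt0.
have q_dvd : q %| x.-1 by rewrite -[q]expn1 pfactor_dvdn ?logn_x.
rewrite -add1n -logn_x -logn_predn_exp // -pfactor_dvdn //; last first.
  by rewrite -subn1 subn_gt0 (leq_ltn_trans _ (ltn_expl k.+1 x_gt1)).
rewrite xE -expnM mulnC expnM.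
apply: dvdn_trans (dvdn_pred_predX _ c); rewrite predn_primeXS // dvdn_mull //.
exact: dvdn_trans (pfactor_dvdnn q n) n_dvd.
Qed.

Lemma dvdn_succ_of_sigma_sqr (p j k m : nat) : prime p -> odd m ->
  sigma (m ^ 2) %| p ^ j -> m ^ 2 %| sigma (p ^ k) -> m %| k.+1.
Proof.
move=> p_pr m_odd sig_dvd m_dvd; have m_gt0 := odd_gt0 m_odd.
apply/dvdn_partP => // q; rewrite mem_primes => /and3P[q_pr _ q_dvd].
rewrite p_part pfactor_dvdn //.
have e_gt0 : 0 < logn q m by rewrite logn_gt0 mem_primes q_pr m_gt0.
have q_odd := dvdn_odd q_dvd m_odd.
have m2_gt0 : 0 < m ^ 2 by rewrite expn_gt0 m_gt0.
have := logn_leq_of_sigma_dvdn p j k q _ p_pr q_pr q_odd m2_gt0 sig_dvd m_dvd.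
by rewrite lognX; lia.
Qed.

Lemma gt5_of_dvdn_sigma_sqr (m s : nat) :
  odd m -> s != 1 -> s %| m ^ 2 -> s %| sigma (m ^ 2) -> 5 < m.
Proof.
move=> m_odd s_neq1 s_dvd s_dvd_sigma.
rewrite ltnNge; apply: contra s_neq1 => m_le5.
by rewrite -dvdn1 -(eqP (coprime_sigma_sqr_lt6 m m_odd m_le5)) dvdn_gcd s_dvd.
Qed.

Lemma sigma_primeX_neq_double_sqr (p j k m : nat) : prime p -> odd k -> odd m ->
  sigma (m ^ 2) %| p ^ j -> sigma (p ^ k) != 2 * m ^ 2.
Proof.
move=> p_pr k_odd m_odd sig_dvd; have k_gt0 := odd_gt0 k_odd.
apply/eqP => sigE.
have [i kE] : exists i, k = (2 * i).+1 by exists k./2; lia.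
have m_dvd : m %| i.+1.
  rewrite -(@Gauss_dvdr _ 2) ?coprimen2 // mulnS -[2 + _]/(2 * i).+2 -kE.
  by apply: dvdn_succ_of_sigma_sqr sig_dvd _; rewrite // sigE dvdn_mull.
have m_le : m <= 2 ^ i by apply: leq_trans (dvdn_leq _ m_dvd) (ltn_expl _ _).
have sqr_le : 2 * m ^ 2 <= p ^ k.
  apply: (@leq_trans (2 ^ k)); last by rewrite leq_exp2r ?prime_gt1.
  by rewrite kE [2 ^ _]expnS leq_pmul2l // mulnC expnM leq_sqr.
by have := ltn_sigma_primeX _ _ p_pr k_gt0; rewrite sigE ltnNge sqr_le.
Qed.

Theorem theorem3 (N p k m : nat)
    (hN : odd_perfect N) (hE : eulerian_form N p k m) :
  (m%:Z ^+ 2 - p%:Z ^+ k > 2 * m%:Z)%R.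
Proof.
case: hN => _ N_odd sigN; case: hE => NE p_pr [k_gt0 _] [p1 k1] /eqP cpm.
have [p_odd k_odd] : odd p /\ odd k by lia.
have m_odd : odd m by move: N_odd; rewrite NE oddM !oddX /= => /andP[].
have [||s sE sigE] := sigma_cofactor 2 p k (m ^ 2) p_pr.
- by rewrite coprimeXr.
- by rewrite -NE.
have s_dvd : s %| m ^ 2.
  by apply: dvdn_of_eq_mul sigE; rewrite // dvdn2 odd_sigma_primeX ?k_odd.
have s_neq1 : s != 1.
  apply: contra_eq_neq sigE => s1; rewrite s1 muln1.
  by apply: (sigma_primeX_neq_double_sqr p k); rewrite // sE s1 mul1n.
have s_gt2 : 2 < s.
  have : odd s by apply: dvdn_odd s_dvd _; rewrite oddX.
  by case: (s) s_neq1 => [|[|[|]]].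
have m_gt5 : 5 < m.
  by apply: gt5_of_dvdn_sigma_sqr s_neq1 s_dvd _; rewrite // sE dvdn_mulr.
have pk_bound : 3 * (p ^ k).+1 <= 2 * m ^ 2.
  by rewrite -sigE mulnC leq_mul ?ltn_sigma_primeX.
have m_bound : 6 * m <= m ^ 2 by rewrite leq_mul2r m_gt5 orbT.
lia.
Qed.
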